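(* There is an algorithm which, given as input two finite $C(2)$ monoid presentations, decides whether the monoids they present are isomorphic.
   Context: A monoid presentation $\langle \mathscr{A} \mid \mathscr{R} \rangle$ consists of an alphabet $\mathscr{A}$ and a set $\mathscr{R} \subseteq \mathscr{A}^* \times \mathscr{A}^*$ of relations (finite if both are finite); the monoid presented is $\mathscr{A}^*$ modulo the smallest congruence containing $\mathscr{R}$. A relation word is a word occurring as one side of a relation. A piece is a word which occurs as a factor of two distinct relation words, or in two different (possibly overlapping) positions within one relation word; the empty word is always a piece. The presentation is $C(2)$ if no relation word can be written as a product of strictly fewer than $2$ pieces. *)

(* Defs.v *)
From mathcomp Require Import all_boot.
Set Implicit Arguments. Unset Strict Implicit. Unset Printing Implicit Defensive.

(* "Algorithm" is rendered as a mu-recursive code (Church-Turing).    *)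

Inductive code : Type :=
| CZero : code
| CSucc : code
| CProj : nat -> code
| CComp : code -> seq code -> code
| CPrec : code -> code -> code
| CMu   : code -> code.

Inductive eval : code -> seq nat -> nat -> Prop :=
| eval_zero v : eval CZero v 0
| eval_succ x v : eval CSucc (x :: v) x.+1
| eval_proj i v : i < size v -> eval (CProj i) v (nth 0 v i)
| eval_comp f gs v ws y :
    evals gs v ws -> eval f ws y -> eval (CComp f gs) v y
| eval_prec0 f g v y : eval f v y -> eval (CPrec f g) (0 :: v) y
| eval_precS f g n v z y :
    eval (CPrec f g) (n :: v) z -> eval g (n :: z :: v) y ->
    eval (CPrec f g) (n.+1 :: v) y
| eval_mu f v n :
    eval f (n :: v) 0 ->
    (forall m, m < n -> exists k, eval f (m :: v) k.+1) ->
    eval (CMu f) v n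
with evals : seq code -> seq nat -> seq nat -> Prop :=
| evals_nil v : evals [::] v [::]
| evals_cons g gs v w ws :
    eval g v w -> evals gs v ws -> evals (g :: gs) v (w :: ws).

Record pres := Pres {
  alpha : nat;
  rels : seq (seq 'I_alpha * seq 'I_alpha)
}.

Definition word (P : pres) := seq 'I_(alpha P).

(* Encoding of a presentation as a natural number (injective, computable). *)
Definition encode (P : pres) : nat :=
  pickle (alpha P, [seq (map val lr.1, map val lr.2) | lr <- rels P]).

Inductive cong (P : pres) : word P -> word P -> Prop :=
| cong_step (l r u v : word P) :
    (l, r) \in rels P -> cong (u ++ l ++ v) (u ++ r ++ v)
| cong_refl (u : word P) : cong u u
| cong_sym (u v : word P) : cong u v -> cong v u
| cong_trans (u v w : word P) : cong u v -> cong v w -> cong u w.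

(* The monoids presented by P and Q are isomorphic: there is a monoid
   homomorphism A_P^*/~P -> A_Q^*/~Q (given on representatives) which
   is bijective (with inverse given on representatives). *)
Definition presented_iso (P Q : pres) : Prop :=
  exists (f : word P -> word Q) (g : word Q -> word P),
    (forall u v, @cong P u v -> @cong Q (f u) (f v)) /\
    (forall u v, @cong Q (f (u ++ v)) (f u ++ f v)) /\
    @cong Q (f [::]) [::] /\
    (forall u v, @cong Q u v -> @cong P (g u) (g v)) /\
    (forall u, @cong P (g (f u)) u) /\
    (forall w, @cong Q (f (g w)) w).

Definition relword (P : pres) (w : word P) : Prop :=
  exists l r, (l, r) \in rels P /\ (w = l \/ w = r).

Definition occurs_at (P : pres) (p w : word P) (i : nat) : Prop :=
  take (size p) (drop i w) = p.

Definition factor (P : pres) (p w : word P) : Prop :=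
  exists i, occurs_at p w i.

Definition piece (P : pres) (p : word P) : Prop :=
  p = [::]
  \/ (exists w1 w2, [/\ relword w1, relword w2, w1 <> w2,
                         factor p w1 & factor p w2])
  \/ (exists w i j, [/\ relword w, i <> j, occurs_at p w i & occurs_at p w j]).

Definition Csc (n : nat) (P : pres) : Prop :=
  forall w : word P, relword w ->
  forall ps : seq (word P), (forall p, p \in ps -> piece p) ->
    flatten ps = w -> n <= size ps.

(* Main.v *)
Require Import Defs.
From mathcomp Require Import all_boot.
Set Implicit Arguments. Unset Strict Implicit. Unset Printing Implicit Defensive.

(* In a C(2) presentation the relation words form an infix code: none is empty
   or a proper factor of another one. Hence a letter which is itself a relation
   word occurs in no other relation word: it is redundant if its class (for the
   equivalence generated by the relations on whole words) contains a word of
   length at least 2, and otherwise it is one of several names of an irreducible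
   element. Eliminating redundant letters and duplicate names reduces every word
   to a word in irreducible letters. Call a word rigid if none of its proper
   factors is equivalent to another reduced word. A rewriting step can change a
   rigid reduced form only by replacing it as a whole, so congruent rigid reduced
   words are equivalent as whole words; relation words are rigid. An isomorphism
   maps irreducible letters to irreducible letters, hence rigid reduced words to
   rigid reduced words of the same length. So isomorphisms are given by generator
   images of bounded length, and verifying one only requires comparing classes of
   whole words, without any word problem: a finite search decides isomorphism. *)

(** * Recursive functions on natural numbers *)

#[local] Hint Resolve eval_zero eval_succ : core.
#[local] Hint Extern 0 (eval (CProj _) _ _) => exact: eval_proj : core.

Lemma eval_comp1 f g v a y :
  eval g v a -> eval f [:: a] y -> eval (CComp f [:: g]) v y.
Proof. by move=> ev_g; apply: eval_comp; apply: evals_cons (evals_nil _). Qed.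

Lemma eval_comp2 f g h v a b y :
  eval g v a -> eval h v b -> eval f [:: a; b] y ->
  eval (CComp f [:: g; h]) v y.
Proof.
move=> ev_g ev_h; apply: eval_comp; apply: evals_cons ev_g _.
exact: evals_cons ev_h (evals_nil _).
Qed.

Lemma eval_prec (F : nat -> nat) f g n v :
  eval f v (F 0) ->
  (forall k, k < n -> eval g (k :: F k :: v) (F k.+1)) ->
  eval (CPrec f g) (n :: v) (F n).
Proof.
move=> ev_f; elim: n => [|n IHn] ev_g; first exact: eval_prec0.
apply: eval_precS (ev_g n (ltnSn n)).
by apply: IHn => k ltkn; apply: ev_g; apply: leqW.
Qed.

Definition code_one := CComp CSucc [:: CZero].

Lemma eval_one v : eval code_one v 1.
Proof. exact: eval_comp1 (eval_zero v) _. Qed.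

Definition code_add := CPrec (CProj 0) (CComp CSucc [:: CProj 1]).

Lemma eval_add x y : eval code_add [:: x; y] (x + y).
Proof. by apply: (eval_prec (F := addn^~ y)) => // k _; apply: eval_comp1. Qed.

Definition code_double := CComp code_add [:: CProj 0; CProj 0].

Lemma eval_double x : eval code_double [:: x] x.*2.
Proof. by rewrite -addnn; apply: eval_comp2 (eval_add _ _). Qed.

Definition code_pred := CPrec CZero (CProj 0).

Lemma eval_pred x : eval code_pred [:: x] x.-1.
Proof. exact: eval_prec. Qed.

Definition code_rsub := CPrec (CProj 0) (CComp code_pred [:: CProj 1]).

Lemma eval_rsub x y : eval code_rsub [:: x; y] (y - x).
Proof.
apply: (eval_prec (F := subn y)) => [|k _]; first by rewrite subn0.
by rewrite subnS; apply: eval_comp1 (eval_pred _).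
Qed.

Definition code_eq0 := CPrec code_one CZero.

Lemma eval_eq0 x : eval code_eq0 [:: x] (x == 0).
Proof. by apply: (eval_prec (F := fun x => x == 0)); first exact: eval_one. Qed.

Definition code_neg f := CComp code_eq0 [:: f].

Lemma eval_neg f v (b : bool) : eval f v b -> eval (code_neg f) v (~~ b).
Proof. by move/eval_comp1; apply; rewrite -eqb0; apply: eval_eq0. Qed.

Definition code_eq :=
  CComp code_eq0
    [:: CComp code_add
          [:: code_rsub; CComp code_rsub [:: CProj 1; CProj 0]]].

Lemma eval_eq x y : eval code_eq [:: x; y] (x == y).
Proof.
have -> : (x == y) = (y - x + (x - y) == 0).
  by rewrite addn_eq0 !subn_eq0 eqn_leq andbC.
apply: eval_comp1 (eval_eq0 _); apply: eval_comp2 (eval_rsub _ _) _ (eval_add _ _).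
exact: eval_comp2 (eval_rsub _ _).
Qed.

Definition code_odd := CPrec CZero (code_neg (CProj 1)).

Lemma eval_odd x : eval code_odd [:: x] (odd x).
Proof. by apply: (eval_prec (F := odd)) => // k _; apply: eval_neg. Qed.

Definition code_half :=
  CPrec CZero (CComp code_add [:: CComp code_odd [:: CProj 0]; CProj 1]).

Lemma eval_half x : eval code_half [:: x] x./2.
Proof.
apply: eval_prec => // k _; rewrite -uphalfE uphalf_half.
by apply: eval_comp2 (eval_add _ _) => //; apply: eval_comp1 (eval_odd k).
Qed.

Definition code_shift := CPrec (CProj 0) (CComp code_half [:: CProj 1]).

Lemma eval_shift k n : eval code_shift [:: k; n] (iter k half n).
Proof.
apply: (eval_prec (F := fun k => iter k half n)) => // i _.
exact: eval_comp1 (eval_half _).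
Qed.

Definition code_cons :=
  CPrec (CComp CSucc [:: code_double]) (CComp code_double [:: CProj 1]).

Lemma eval_cons x s :
  eval code_cons [:: x; CodeSeq.code s] (CodeSeq.code (x :: s)).
Proof.
pose F x := CodeSeq.code (x :: s); apply: (eval_prec (F := F)) => [|k _].
  by rewrite /F /= mul1n; apply: eval_comp1 (eval_double _) _.
rewrite /F /= expnS -mulnA mul2n; exact: eval_comp1 (eval_double _).
Qed.

Lemma iter_half_expn x m y :
  m <= x -> iter m half (2 ^ x * y) = 2 ^ (x - m) * y.
Proof.
move/subnK=> {1}<-; rewrite addnC expnD -mulnA.
by elim: m (_ * y) => [|m IHm] z; rewrite ?mul1n // iterSr expnS -mulnA mul2n doubleK.
Qed.

(* The head of [x :: s] is the position of the lowest bit set in its code. *)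
Definition code_head := CMu (code_neg (CComp code_odd [:: code_shift])).

Lemma eval_head x s : eval code_head [:: CodeSeq.code (x :: s)] x.
Proof.
rewrite /=; set n := 2 ^ x * _.
have ev m : eval (code_neg (CComp code_odd [:: code_shift])) [:: m; n]
                 (~~ odd (iter m half n)).
  by apply: eval_neg; apply: eval_comp1 (eval_shift m n) (eval_odd _).
apply: eval_mu => [|m ltmx].
  by have := ev x; rewrite iter_half_expn // subnn mul1n /= odd_double.
exists 0; have := ev m.
by rewrite iter_half_expn 1?ltnW // -(subnSK ltmx) expnS -mulnA mul2n odd_double.
Qed.

Definition code_behead :=
  CComp code_half [:: CComp code_shift [:: code_head; CProj 0]].

Lemma eval_behead x s :
  eval code_behead [:: CodeSeq.code (x :: s)] (CodeSeq.code s).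
Proof.
apply: (@eval_comp1 _ _ _ (CodeSeq.code s).*2.+1).
  apply: (eval_comp2 (eval_head x s)) => //.
  have := eval_shift x (CodeSeq.code (x :: s)).
  by rewrite iter_half_expn // subnn mul1n.
by have := eval_half (CodeSeq.code s).*2.+1; rewrite -uphalfE uphalf_double.
Qed.

(* [d] is evaluated even if [b] holds: the recursion starts from its value. *)
Definition code_if b c d := CComp (CPrec d (CComp c [:: CProj 2])) [:: b; CProj 0].

Lemma eval_if b c d x y z (t : bool) :
  eval b [:: x] t -> (t -> eval c [:: x] y) -> eval d [:: x] z ->
  eval (code_if b c d) [:: x] (if t then y else z).
Proof.
move=> ev_b ev_c ev_d; apply: (eval_comp2 ev_b) => //.
case: t ev_c {ev_b} => [/(_ isT) ev_c|_]; last exact: eval_prec0.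
by apply: eval_precS; [apply: eval_prec0 ev_d | apply: eval_comp1 ev_c].
Qed.

(** * Computable functions between countable types *)

Definition computable (A B : countType) (f : A -> B) : Prop :=
  exists c, forall a, eval c [:: pickle a] (pickle (f a)).

Definition computable2 (A B C : countType) (f : A -> B -> C) : Prop :=
  computable (fun p : A * B => f p.1 p.2).

Definition computable3 (A B C D : countType) (f : A -> B -> C -> D) : Prop :=
  computable2 (fun p : A * B => f p.1 p.2).

Lemma pickle_bool (b : bool) : pickle b = b.
Proof. by []. Qed.

Lemma eval_pickle_cons (A : countType) (a : A) s :
  eval code_cons [:: pickle a; pickle s] (pickle (a :: s)).
Proof. exact: eval_cons. Qed.

Lemma size_le_pickle (A : countType) (s : seq A) : size s <= pickle s.
Proof.
elim: s => //= a s IHs; rewrite -[_.+1]mul1n.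
rewrite -[pickle _]/(2 ^ pickle a * (pickle s).*2.+1) leq_mul ?expn_gt0 //.
by rewrite ltnS (leq_trans IHs) // -addnn leq_addr.
Qed.

Definition code_pair :=
  CComp code_cons [:: CProj 0; CComp code_cons [:: CProj 1; CZero]].

Lemma eval_pair (A B : countType) (a : A) (b : B) :
  eval code_pair [:: pickle a; pickle b] (pickle (a, b)).
Proof.
apply: eval_comp2 (eval_cons _ [:: _]) => //.
exact: eval_comp2 (eval_cons _ [::]).
Qed.

Definition code_snd := CComp code_head [:: code_behead].

Lemma eval_fst (A B : countType) (p : A * B) :
  eval code_head [:: pickle p] (pickle p.1).
Proof. by case: p => a b; apply: eval_head. Qed.

Lemma eval_snd (A B : countType) (p : A * B) :
  eval code_snd [:: pickle p] (pickle p.2).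
Proof.
by case: p => a b; apply: eval_comp1 (eval_behead _ [:: _]) (eval_head _ [::]).
Qed.

Lemma computable_ext (E A : countType) (f g : E -> A) :
  f =1 g -> computable f -> computable g.
Proof. by move=> eq_fg [c ev_c]; exists c => e; rewrite -eq_fg. Qed.

Lemma computable_comp (E A B : countType) (h : A -> B) (f : E -> A) :
  computable h -> computable f -> computable (fun e => h (f e)).
Proof.
move=> [c ev_c] [d ev_d]; exists (CComp c [:: d]) => e.
exact: eval_comp1 (ev_d e) (ev_c _).
Qed.

Lemma computable_pair (E A B : countType) (f : E -> A) (g : E -> B) :
  computable f -> computable g -> computable (fun e => (f e, g e)).
Proof.
move=> [c ev_c] [d ev_d]; exists (CComp code_pair [:: c; d]) => e.
exact: eval_comp2 (ev_c e) (ev_d e) (eval_pair _ _).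
Qed.

Lemma computable_fst (A B : countType) : computable (@fst A B).
Proof. by exists code_head; apply: eval_fst. Qed.

Lemma computable_snd (A B : countType) : computable (@snd A B).
Proof. by exists code_snd; apply: eval_snd. Qed.

Lemma computable_comp2 (E A B C : countType) (h : A -> B -> C)
    (f : E -> A) (g : E -> B) :
  computable2 h -> computable f -> computable g ->
  computable (fun e => h (f e) (g e)).
Proof. by move=> ch cf cg; apply: (computable_comp ch (computable_pair cf cg)). Qed.

Lemma computable_comp3 (E A B C D : countType) (h : A -> B -> C -> D)
    (f : E -> A) (g : E -> B) (k : E -> C) :
  computable3 h -> computable f -> computable g -> computable k ->
  computable (fun e => h (f e) (g e) (k e)).
Proof.
move=> ch cf cg; pose h' (p : A * B) := h p.1 p.2.
exact: (computable_comp2 (h := h') ch (computable_pair cf cg)).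
Qed.

Create HintDb computable.

#[local] Hint Resolve computable_fst computable_snd : computable.
#[local] Hint Extern 1 (computable (fun e => fst _)) =>
  apply: (computable_comp (computable_fst _ _)) : computable.
#[local] Hint Extern 1 (computable (fun e => snd _)) =>
  apply: (computable_comp (computable_snd _ _)) : computable.
#[local] Hint Extern 1 (computable (fun e => (_, _))) =>
  apply: computable_pair : computable.
#[local] Hint Extern 1 (computable2 _) => rewrite /computable2 : computable.
#[local] Hint Extern 1 (computable3 _) => rewrite /computable3 : computable.
#[local] Hint Extern 2 (computable (fun e => _)) =>
  match goal with
  | ch : computable ?h |- computable (fun e => ?h _) =>
      apply: (computable_comp ch)
  | ch : computable2 ?h |- computable (fun e => ?h _ _) =>
      apply: (computable_comp2 ch)
  | ch : computable3 ?h |- computable (fun e => ?h _ _ _) =>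
      apply: (computable_comp3 ch)
  end : computable.

Section Constructors.

Variable E : countType.

Lemma computable_zero : computable (fun _ : E => 0).
Proof. by exists CZero. Qed.

Lemma computable_succ : computable S.
Proof. by exists CSucc. Qed.

Lemma computable_false : computable (fun _ : E => false).
Proof. by exists CZero. Qed.

Lemma computable_true : computable (fun _ : E => true).
Proof. by exists code_one => e; apply: eval_one. Qed.

Lemma computable_nil (A : countType) : computable (fun _ : E => [::] : seq A).
Proof. by exists CZero. Qed.

Lemma computable_cons (A : countType) (f : E -> A) (g : E -> seq A) :
  computable f -> computable g -> computable (fun e => f e :: g e).
Proof.
move=> [c ev_c] [d ev_d]; exists (CComp code_cons [:: c; d]) => e.
exact: eval_comp2 (ev_c e) (ev_d e) (eval_pickle_cons _ _).
Qed.

Lemma computable_eq (A : countType) (f g : E -> A) :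
  computable f -> computable g -> computable (fun e => f e == g e).
Proof.
move=> [c ev_c] [d ev_d]; exists (CComp code_eq [:: c; d]) => e.
rewrite pickle_bool -(inj_eq (pcan_inj pickleK)).
exact: eval_comp2 (ev_c e) (ev_d e) (eval_eq _ _).
Qed.

Lemma computable_if (A : countType) (b : E -> bool) (f g : E -> A) :
  computable b -> computable f -> computable g ->
  computable (fun e => if b e then f e else g e).
Proof.
move=> [cb ev_b] [c ev_c] [d ev_d]; exists (code_if cb c d) => e.
by rewrite (fun_if pickle); apply: eval_if (ev_d e).
Qed.

Lemma computable_match (A T : countType) (s : E -> seq T) (z : E -> A)
    (f : E -> T -> seq T -> A) :
  computable s -> computable z -> computable3 f ->
  computable (fun e => if s e is x :: s' then f e x s' else z e).
Proof.
move=> [cs ev_s] [cz ev_z] [c ev_c].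
pose arg := CComp code_pair
  [:: CComp code_pair [:: CProj 0; CComp code_head [:: cs]];
      CComp code_behead [:: cs]].
pose nonempty := code_neg (CComp code_eq0 [:: cs]).
exists (code_if nonempty (CComp c [:: arg]) cz) => e.
have ev_nonempty : eval nonempty [:: pickle e] (pickle (s e) != 0).
  by apply: eval_neg; apply: eval_comp1 (ev_s e) (eval_eq0 _).
case: (s e) (ev_s e) ev_nonempty => [|x s'] ev_xs ev_nonempty.
  exact: (eval_if (y := 0) (t := false) ev_nonempty _ (ev_z e)).
have xs_neq0 : pickle (x :: s') != 0 by rewrite muln_eq0 negb_or -lt0n expn_gt0.
rewrite xs_neq0 in ev_nonempty; apply: (eval_if ev_nonempty _ (ev_z e)) => _.
apply: (@eval_comp1 _ _ _ (pickle (e, x, s'))); last exact: (ev_c (e, x, s')).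
apply: eval_comp2 (eval_pair (e, x) s').
  by apply: eval_comp2 (eval_pair e x) => //; apply: eval_comp1 ev_xs (eval_head _ _).
exact: eval_comp1 ev_xs (eval_behead _ _).
Qed.

Lemma computable_iter (A : countType) (n : E -> nat) (f : E -> A -> A) (z : E -> A) :
  computable n -> computable z -> computable2 f ->
  computable (fun e => iter (n e) (f e) (z e)).
Proof.
move=> [cn ev_n] [cz ev_z] [c ev_c].
pose step := CComp c [:: CComp code_pair [:: CProj 2; CProj 1]].
exists (CComp (CPrec cz step) [:: cn; CProj 0]) => e.
apply: (eval_comp2 (ev_n e)) => //.
apply: (eval_prec (F := fun k => pickle (iter k (f e) (z e)))) => [|k _].
  exact: ev_z.
apply: eval_comp1 (ev_c (e, iter k (f e) (z e))).
exact: eval_comp2 (eval_pair _ _).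
Qed.

End Constructors.

#[local] Hint Resolve computable_zero computable_succ computable_false
  computable_true computable_nil : computable.
#[local] Hint Extern 1 (computable (fun e => S _)) =>
  apply: (computable_comp computable_succ) : computable.
#[local] Hint Extern 1 (computable (fun e => cons _ _)) =>
  apply: computable_cons : computable.
#[local] Hint Extern 1 (computable (fun e => _ == _)) =>
  apply: computable_eq : computable.
#[local] Hint Extern 1 (computable (fun e => if _ then _ else _)) =>
  apply: computable_if : computable.
#[local] Hint Extern 1 (computable (fun e => iter _ _ _)) =>
  apply: computable_iter : computable.
#[local] Hint Extern 1
    (computable (fun e => match _ with nil => _ | cons x s => _ end)) =>
  apply: computable_match : computable.

Ltac computability := auto 30 with computable.

Definition foldl_step (A T : Type) (f : A -> T -> A) (p : seq T * A) : seq T * A :=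
  if p.1 is x :: s then (s, f p.2 x) else p.

Lemma iter_foldl_step (A T : Type) (f : A -> T -> A) k s z :
  size s <= k -> iter k (foldl_step f) (s, z) = ([::], foldl f z s).
Proof.
elim: k s z => [|k IHk] [|x s] z //= lesk; last by rewrite -iterS iterSr IHk.
by rewrite IHk.
Qed.

Lemma computable_foldl (E A T : countType) (s : E -> seq T) (z : E -> A)
    (f : E -> A -> T -> A) :
  computable s -> computable z -> computable3 f ->
  computable (fun e => foldl (f e) (z e) (s e)).
Proof.
move=> cs cz cf.
pose g e := (iter (pickle (s e)) (foldl_step (f e)) (s e, z e)).2.
apply: (computable_ext (f := g)) => [e|].
  by rewrite /g iter_foldl_step ?size_le_pickle.
have computable_bound : computable (fun e => pickle (s e)) by have [c] := cs; exists c.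
by rewrite /g /foldl_step; computability.
Qed.

#[local] Hint Extern 1 (computable (fun e => foldl _ _ _)) =>
  apply: computable_foldl : computable.

Lemma computable_rev (E T : countType) (s : E -> seq T) :
  computable s -> computable (fun e => rev (s e)).
Proof.
move=> cs; apply: (computable_ext (f := fun e => foldl (fun t x => x :: t) [::] (s e))).
  by move=> e; rewrite /rev; elim: (s e) [::] => //= x s' IHs t.
by computability.
Qed.

#[local] Hint Extern 1 (computable (fun e => rev _)) =>
  apply: computable_rev : computable.

Lemma computable_foldr (E A T : countType) (s : E -> seq T) (z : E -> A)
    (f : E -> T -> A -> A) :
  computable s -> computable z -> computable3 f ->
  computable (fun e => foldr (f e) (z e) (s e)).
Proof.
move=> cs cz cf.
apply: (computable_ext (f := fun e => foldl (fun y x => f e x y) (z e) (rev (s e)))).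
  by move=> e; rewrite foldl_rev.
by computability.
Qed.

#[local] Hint Extern 1 (computable (fun e => foldr _ _ _)) =>
  apply: computable_foldr : computable.

Section Sequences.

Variables E T U : countType.
Implicit Types (s : E -> seq T) (a : E -> T -> bool).

Lemma computable_cat s t :
  computable s -> computable t -> computable (fun e => s e ++ t e).
Proof.
move=> cs ct; apply: (computable_ext (f := fun e => foldr cons (t e) (s e))).
  by move=> e; elim: (s e) => //= x s' ->.
by computability.
Qed.

Lemma computable_size s : computable s -> computable (fun e => size (s e)).
Proof.
move=> cs; apply: (computable_ext (f := fun e => foldr (fun=> S) 0 (s e))).
  by move=> e; elim: (s e) => //= x s' ->.
by computability.
Qed.

Lemma computable_all s a :
  computable s -> computable2 a -> computable (fun e => all (a e) (s e)).
Proof.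
move=> cs ca.
pose g e := foldr (fun x b => if a e x then b else false) true (s e).
apply: (computable_ext (f := g)) => [e|]; last by rewrite /g; computability.
by rewrite /g; elim: (s e).
Qed.

Lemma computable_has s a :
  computable s -> computable2 a -> computable (fun e => has (a e) (s e)).
Proof.
move=> cs ca.
pose g e := foldr (fun x b => if a e x then true else b) false (s e).
apply: (computable_ext (f := g)) => [e|]; last by rewrite /g; computability.
by rewrite /g; elim: (s e).
Qed.

Lemma computable_map s (f : E -> T -> U) :
  computable s -> computable2 f -> computable (fun e => map (f e) (s e)).
Proof.
move=> cs cf; pose g e := foldr (fun x t => f e x :: t) [::] (s e).
apply: (computable_ext (f := g)) => [e|]; last by rewrite /g; computability.
by rewrite /g; elim: (s e) => //= x s' ->.
Qed.

Lemma computable_nth z s (i : E -> nat) :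
  computable z -> computable s -> computable i ->
  computable (fun e => nth (z e) (s e) (i e)).
Proof.
move=> cz cs ci.
pose g e := if iter (i e) behead (s e) is x :: _ then x else z e.
apply: (computable_ext (f := g)) => [e|]; last by rewrite /g /behead; computability.
by rewrite /g; elim: (i e) (s e) => [|k IHk] [|x s'] //; rewrite iterSr IHk ?nth_nil.
Qed.

End Sequences.

#[local] Hint Extern 1 (computable (fun e => _ ++ _)) =>
  apply: computable_cat : computable.
#[local] Hint Extern 1 (computable (fun e => size _)) =>
  apply: computable_size : computable.
#[local] Hint Extern 1 (computable (fun e => all _ _)) =>
  apply: computable_all : computable.
#[local] Hint Extern 1 (computable (fun e => has _ _)) =>
  apply: computable_has : computable.
#[local] Hint Extern 1 (computable (fun e => map _ _)) =>
  apply: computable_map : computable.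
#[local] Hint Extern 1 (computable (fun e => nth _ _ _)) =>
  apply: computable_nth : computable.

Lemma computable_andb (E : countType) (a b : E -> bool) :
  computable a -> computable b -> computable (fun e => a e && b e).
Proof. by move=> ca cb; rewrite /andb; computability. Qed.

Lemma computable_flatten (E T : countType) (s : E -> seq (seq T)) :
  computable s -> computable (fun e => flatten (s e)).
Proof. by move=> cs; rewrite /flatten; computability. Qed.

Lemma computable_iota (E : countType) (n : E -> nat) :
  computable n -> computable (fun e => iota 0 (n e)).
Proof.
move=> cn; pose g e := iter (n e) (fun s => s ++ [:: size s]) [::].
apply: (computable_ext (f := g)) => [e|]; last by rewrite /g; computability.
rewrite /g; elim: (n e) => [|k IHk] //.
by rewrite iterS IHk size_iota -[in RHS]addn1 iotaD.
Qed.

#[local] Hint Extern 1 (computable (fun e => _ && _)) =>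
  apply: computable_andb : computable.
#[local] Hint Extern 1 (computable (fun e => flatten _)) =>
  apply: computable_flatten : computable.
#[local] Hint Extern 1 (computable (fun e => iota 0 _)) =>
  apply: computable_iota : computable.

(** * The decision procedure *)

(* Union-find: each pair [(x, y)] of the list redirects [x] to [y]. *)
Definition redirect (W : eqType) (s : seq (W * W)) (x : W) : W :=
  foldr (fun p y => if y == p.1 then p.2 else y) x s.

Definition redirections (W : eqType) (R : seq (W * W)) : seq (W * W) :=
  foldr (fun lr s => (redirect s lr.1, redirect s lr.2) :: s) [::] R.

Definition class_rep (W : eqType) (R : seq (W * W)) (x : W) : W :=
  redirect (redirections R) x.

Definition seqs_upto (T : Type) (C : seq T) (k : nat) : seq (seq T) :=
  iter k (fun S => [::] :: [seq x :: w | x <- C, w <- S]) [:: [::]].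

Definition free_hom (A B : Type) (f : A -> seq B) (u : seq A) : seq B :=
  flatten (map f u).

Definition pres_data : Type := nat * seq (seq nat * seq nat).

(* At least 1, the length of the normal form of an irreducible letter. *)
Definition length_bound (p : pres_data) : nat :=
  (size (flatten [seq lr.1 ++ lr.2 | lr <- p.2])).+1.

Definition candidates (p q : pres_data) : seq (seq (seq nat)) :=
  seqs_upto (seqs_upto (iota 0 q.1) (length_bound p)) p.1.

Definition check_retracted_hom (p q : pres_data) (f g : seq (seq nat)) : bool :=
  all (fun lr => class_rep q.2 (free_hom (nth [::] f) lr.1)
                 == class_rep q.2 (free_hom (nth [::] f) lr.2)) p.2
  && all (fun a => class_rep p.2 (free_hom (nth [::] g) (nth [::] f a))
                   == class_rep p.2 [:: a]) (iota 0 p.1).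

Definition check_iso (p q : pres_data) (f g : seq (seq nat)) : bool :=
  check_retracted_hom p q f g && check_retracted_hom q p g f.

Definition decide_iso (p q : pres_data) : bool :=
  has (fun f => has (check_iso p q f) (candidates q p)) (candidates p q).

Section ComputableProcedure.

Variable E : countType.

Lemma computable_class_rep (W : countType) (R : E -> seq (W * W)) (x : E -> W) :
  computable R -> computable x -> computable (fun e => class_rep (R e) (x e)).
Proof.
by move=> cR cx; rewrite /class_rep /redirections /redirect; computability.
Qed.

Lemma computable_seqs_upto (T : countType) (C : E -> seq T) (k : E -> nat) :
  computable C -> computable k -> computable (fun e => seqs_upto (C e) (k e)).
Proof. by move=> cC ck; rewrite /seqs_upto; computability. Qed.

Lemma computable_free_hom (A B : countType) (f : E -> A -> seq B) (u : E -> seq A) :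
  computable2 f -> computable u -> computable (fun e => free_hom (f e) (u e)).
Proof. by move=> cf cu; rewrite /free_hom; computability. Qed.

End ComputableProcedure.

#[local] Hint Extern 1 (computable (fun e => class_rep _ _)) =>
  apply: computable_class_rep : computable.
#[local] Hint Extern 1 (computable (fun e => seqs_upto _ _)) =>
  apply: computable_seqs_upto : computable.
#[local] Hint Extern 1 (computable (fun e => free_hom _ _)) =>
  apply: computable_free_hom : computable.

Lemma computable_candidates : computable2 candidates.
Proof. by rewrite /candidates /length_bound; computability. Qed.

Lemma computable_check_retracted_hom (E : countType) (p q : E -> pres_data) f g :
  computable p -> computable q -> computable f -> computable g ->
  computable (fun e => check_retracted_hom (p e) (q e) (f e) (g e)).
Proof. by move=> cp cq cf cg; rewrite /check_retracted_hom; computability. Qed.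

#[local] Hint Extern 1 (computable (fun e => check_retracted_hom _ _ _ _)) =>
  apply: computable_check_retracted_hom : computable.
#[local] Hint Extern 1 (computable (fun e => candidates _ _)) =>
  apply: (computable_comp2 computable_candidates) : computable.

Lemma computable_decide_iso : computable2 decide_iso.
Proof. by rewrite /decide_iso /check_iso; computability. Qed.

Lemma free_hom_cat (A B : Type) (f : A -> seq B) u v :
  free_hom f (u ++ v) = free_hom f u ++ free_hom f v.
Proof. by rewrite /free_hom map_cat flatten_cat. Qed.

Lemma free_hom_seq1 (A B : Type) (f : A -> seq B) a : free_hom f [:: a] = f a.
Proof. exact: cats0. Qed.

Lemma size_free_hom_ge (A B : Type) (f : A -> seq B) u :
  (forall a, f a <> [::]) -> size u <= size (free_hom f u).
Proof.
move=> f_neq0; elim: u => // a u IHu; rewrite /free_hom /= size_cat -add1n leq_add //.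
by case: (f a) (f_neq0 a).
Qed.

Lemma free_hom_comp (A B C : Type) (g : B -> seq C) (f : A -> seq B) u :
  free_hom g (free_hom f u) = free_hom (fun a => free_hom g (f a)) u.
Proof. by elim: u => // a u IHu; rewrite free_hom_cat IHu. Qed.

Lemma mem_seqs_upto (T : eqType) (C : seq T) k s :
  (s \in seqs_upto C k) = (size s <= k) && all (mem C) s.
Proof.
elim: k s => [|k IHk] [|x s] //.
rewrite /seqs_upto iterS -/(seqs_upto C k) in_cons /= ltnS.
apply/allpairsP/and3P=> [[[y w] /= [yC wk [-> ->]]]|[sk xC sC]].
  by move: wk; rewrite IHk => /andP[].
by exists (x, s); split; rewrite //= IHk sk.
Qed.

(** * The equivalence relation generated by a list of pairs *)

Lemma class_rep_cons (W : eqType) (R : seq (W * W)) lr x :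
  class_rep (lr :: R) x =
  if class_rep R x == class_rep R lr.1 then class_rep R lr.2 else class_rep R x.
Proof. by []. Qed.

Section ClassRepEquiv.

Variables (W : eqType) (E : W -> W -> Prop).
Hypothesis E_refl : forall x, E x x.
Hypothesis E_sym : forall x y, E x y -> E y x.
Hypothesis E_trans : forall x y z, E x y -> E y z -> E x z.

Lemma class_rep_sub_equiv R x :
  (forall l r, (l, r) \in R -> E l r) -> E x (class_rep R x).
Proof.
elim: R x => [//|[l r] R IHR] x E_lrR.
have {}IHR y : E y (class_rep R y).
  by apply: IHR => l' r' lrR; apply: E_lrR; rewrite inE lrR orbT.
rewrite class_rep_cons /=; case: eqP => // eq_xl.
apply: E_trans (IHR x) _; rewrite eq_xl; apply: E_trans (E_sym (IHR l)) _.
by apply: E_trans (IHR r); apply: E_lrR; apply: mem_head.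
Qed.

Lemma eq_class_rep_sub_equiv R x y :
  (forall l r, (l, r) \in R -> E l r) -> class_rep R x = class_rep R y -> E x y.
Proof.
move=> E_R eq_xy; apply: E_trans (class_rep_sub_equiv x E_R) _.
by rewrite eq_xy; apply: E_sym; apply: class_rep_sub_equiv.
Qed.

End ClassRepEquiv.

Lemma class_rep_rel (W : eqType) (R : seq (W * W)) l r :
  (l, r) \in R -> class_rep R l = class_rep R r.
Proof.
elim: R => [//|lr R IHR]; rewrite inE !class_rep_cons => /orP[/eqP <- /=|/IHR -> //].
by rewrite eqxx; case: eqP.
Qed.

Lemma class_rep_idem (W : eqType) (R : seq (W * W)) x :
  class_rep R (class_rep R x) = class_rep R x.
Proof.
apply/esym; apply: (@class_rep_sub_equiv _ (fun x y => class_rep R x = class_rep R y)).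
- by [].
- by move=> ? ? ->.
- by move=> ? ? ? -> ->.
exact: class_rep_rel.
Qed.

Lemma class_rep_map (W W' : eqType) (h : W -> W') (R : seq (W * W)) x :
  injective h ->
  class_rep [seq (h lr.1, h lr.2) | lr <- R] (h x) = h (class_rep R x).
Proof.
move=> h_inj; elim: R x => [//|lr R IHR] x.
by rewrite map_cons !class_rep_cons /= !IHR inj_eq //; case: eqP.
Qed.

(** * Congruence and whole-word equivalence *)

Section Congruence.

Variable P : pres.
Implicit Types l r u v w x y : word P.

Lemma cong_context x y u v : cong u v -> cong (x ++ u ++ y) (x ++ v ++ y).
Proof.
elim=> [l r u' v' lrP | u' | u' v' _ | u' v' w' _ uv _].
- rewrite -!catA (catA x) (catA x u' (r ++ _)); exact: cong_step.
- exact: cong_refl.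
- exact: cong_sym.
exact: cong_trans.
Qed.

Lemma cong_cat u u' v v' : cong u u' -> cong v v' -> cong (u ++ v) (u' ++ v').
Proof.
move=> /(cong_context [::] v) uu' /(cong_context u' [::]).
by rewrite !cats0; apply: cong_trans.
Qed.

Lemma cong_free_hom (A : Type) (f g : A -> word P) (s : seq A) :
  (forall a, cong (f a) (g a)) -> cong (free_hom f s) (free_hom g s).
Proof. by move=> fg; elim: s => [|a s IHs]; [apply: cong_refl | apply: cong_cat]. Qed.

Definition rep u : word P := class_rep (rels P) u.

Lemma rel_rep l r : (l, r) \in rels P -> rep l = rep r.
Proof. exact: class_rep_rel. Qed.

Lemma rep_cong u v : rep u = rep v -> cong u v.
Proof.
apply: eq_class_rep_sub_equiv; [exact: cong_refl|exact: cong_sym|exact: cong_trans|].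
by move=> l r /(cong_step [::] [::]); rewrite !cats0.
Qed.

Lemma rel_relword l r : (l, r) \in rels P -> relword l /\ relword r.
Proof. by move=> lrP; split; exists l, r; split=> //; [left | right]. Qed.

Lemma rep_eq_or_relword u v : rep u = rep v -> u = v \/ relword u /\ relword v.
Proof.
pose E u v := u = v \/ relword u /\ relword v.
apply: (eq_class_rep_sub_equiv (E := E)) => [w|x y|x y z|l r /rel_relword].
- by left.
- by case=> [->|[]]; [left | right].
- by case=> [-> //|[rx ry]] [<-|[_ rz]]; right.
by right.
Qed.

Definition relwords : seq (word P) := flatten [seq [:: lr.1; lr.2] | lr <- rels P].

Lemma relwordsP w : reflect (relword w) (w \in relwords).
Proof.
apply: (iffP flatten_mapP) => [[[l r] lrP]|[l [r [lrP wlr]]]]; last first.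
  by exists (l, r); rewrite //= !inE; case: wlr => ->; rewrite eqxx ?orbT.
by have [rl rr] := rel_relword lrP; rewrite !inE => /orP[] /eqP ->.
Qed.

End Congruence.

(** * Reduced words *)

Section Reduction.

Variable P : pres.
Implicit Types (a b : 'I_(alpha P)) (u v w x y : word P).

(* The list is empty when the class of [a] consists of letters: [a] is then
   replaced by the letter representing its class. *)
Definition letter_nf a : word P :=
  head (rep [:: a]) [seq w <- relwords P | (1 < size w) && (rep w == rep [:: a])].

Lemma rep_letter_nf a : rep (letter_nf a) = rep [:: a].
Proof.
rewrite /letter_nf; case def_s: [seq _ <- _ | _] => [|w s] /=.
  exact: class_rep_idem.
by have := mem_head w s; rewrite -def_s mem_filter => /andP[/andP[_ /eqP]].
Qed.

Lemma eq_letter_nf a b : rep [:: a] = rep [:: b] -> letter_nf a = letter_nf b.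
Proof. by rewrite /letter_nf => ->. Qed.

Definition reduce : word P -> word P := free_hom letter_nf.

Lemma reduce_cat u v : reduce (u ++ v) = reduce u ++ reduce v.
Proof. exact: free_hom_cat. Qed.

Lemma reduce_seq1 a : reduce [:: a] = letter_nf a.
Proof. exact: free_hom_seq1. Qed.

Lemma reduce_cong u : cong (reduce u) u.
Proof.
rewrite -[u in cong _ u]flatten_seq1; apply: cong_free_hom => a.
exact: rep_cong (rep_letter_nf a).
Qed.

Definition irreducible a : bool := letter_nf a == [:: a].

Definition reduced : pred (word P) := all irreducible.

Lemma reduced_cat u v : reduced (u ++ v) = reduced u && reduced v.
Proof. exact: all_cat. Qed.

Lemma reduce_id u : reduced u -> reduce u = u.
Proof.
elim: u => // a u IHu /= /andP[/eqP nf_a /IHu red_u].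
by rewrite -cat1s reduce_cat red_u reduce_seq1 nf_a.
Qed.

Definition rigid u : Prop :=
  forall x w y w', u = x ++ w ++ y -> reduced w' -> rep w = rep w' -> w <> w' ->
    x = [::] /\ y = [::].

End Reduction.

(** * Presentations whose relation words form an infix code *)

Definition infix_code (P : pres) : Prop :=
  ~ relword ([::] : word P) /\
  forall x w y : word P,
    relword (x ++ w ++ y) -> relword w -> x = [::] /\ y = [::].

Lemma Csc2_piece_not_relword (P : pres) (w : word P) :
  Csc 2 P -> piece w -> ~ relword w.
Proof.
move=> P_C2 w_piece rw; have w_pieces p : p \in [:: w] -> piece p.
  by rewrite inE => /eqP ->.
by have := P_C2 w rw [:: w] w_pieces (cats0 w).
Qed.

Lemma Csc2_infix_code (P : pres) : Csc 2 P -> infix_code P.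
Proof.
move=> P_C2; split=> [|x w y rxwy rw].
  by apply: Csc2_piece_not_relword => //; left.
have [eq_w|/eqP neq_w] := eqVneq w (x ++ w ++ y).
  have /eqP := congr1 size eq_w; rewrite !size_cat addnCA -[X in X == _]addn0.
  by rewrite eqn_add2l eq_sym addn_eq0 !size_eq0 => /andP[/eqP -> /eqP ->].
case: (Csc2_piece_not_relword (w := w)) => //; right; left; exists w, (x ++ w ++ y).
split=> //; first by exists 0; rewrite /occurs_at drop0 take_size.
by exists (size x); rewrite /occurs_at drop_size_cat // take_size_cat.
Qed.

Section InfixCode.

Variable P : pres.
Hypothesis P_code : infix_code P.
Implicit Types (a : 'I_(alpha P)) (l r u v w x y : word P).

Lemma relword_neq0 u : relword u -> u <> [::].
Proof. by move=> + u0; rewrite u0; have [] := P_code. Qed.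

Lemma relword_factor x w y :
  relword (x ++ w ++ y) -> relword w -> x = [::] /\ y = [::].
Proof. by have [_] := P_code; apply. Qed.

Lemma rep_eq_nil u : rep u = @rep P [::] -> u = [::].
Proof. by case/rep_eq_or_relword=> // -[_ /relword_neq0]. Qed.

Lemma letter_nf_neq0 a : letter_nf a <> [::].
Proof. by move=> a0; have := rep_letter_nf a; rewrite a0 => /esym/rep_eq_nil. Qed.

Lemma long_relword_reduced w : relword w -> 1 < size w -> reduced w.
Proof.
move=> rw w_gt1; apply/allP=> a aw.
case: (rep_eq_or_relword (rep_letter_nf a)) => [/eqP //|[_ ra]].
case: (path.splitPr aw) rw w_gt1 => x y rxay.
by have [-> ->] := relword_factor (w := [:: a]) rxay ra.
Qed.

Lemma letter_nf_reduced a : reduced (letter_nf a).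
Proof.
case: (ltnP 1 (size (letter_nf a))) => [nf_gt1|nf_le1].
  case: (rep_eq_or_relword (rep_letter_nf a)) => [nf_a|[rnf _]].
    by rewrite nf_a in nf_gt1.
  exact: long_relword_reduced.
have := @letter_nf_neq0 a; have := rep_letter_nf a.
case def_b: (letter_nf a) nf_le1 => [|b [|//]] // _ rep_b _.
by rewrite /reduced /= /irreducible (eq_letter_nf rep_b) def_b eqxx.
Qed.

Lemma rep_irreducible a u :
  irreducible a -> reduced u -> rep u = rep [:: a] -> u = [:: a].
Proof.
move=> /eqP nf_a red_u rep_u; have [u_gt1|] := ltnP 1 (size u).
  have [u_a|[/relwordsP ru _]] := rep_eq_or_relword rep_u.
    by rewrite u_a in u_gt1.
  move: nf_a; rewrite /letter_nf; case def_s: [seq _ <- _ | _] => [|w s] /= w_a.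
    suff : u \in [::] by [].
    by rewrite -def_s mem_filter u_gt1 rep_u eqxx.
  have := mem_head w s; rewrite -def_s mem_filter => /andP[/andP[+ _] _].
  by rewrite w_a.
case: u red_u rep_u => [_ /esym/rep_eq_nil //|b [|//]].
by rewrite /reduced /= andbT => /eqP nf_b /eq_letter_nf; rewrite nf_a nf_b.
Qed.

Lemma reduce_reduced u : reduced (reduce u).
Proof.
elim: u => // a u IHu.
by rewrite -cat1s reduce_cat reduced_cat IHu reduce_seq1 letter_nf_reduced.
Qed.

Lemma reduce_eq_nil u : reduce u = [::] -> u = [::].
Proof.
move=> u0; apply: size0nil; apply/eqP; rewrite -leqn0 -[0]/(size ([::] : word P)) -u0.
exact: size_free_hom_ge letter_nf_neq0.
Qed.

Lemma rep_reduce_relword u : relword u -> rep (reduce u) = rep u.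
Proof.
case: (ltnP 1 (size u)) => [u_gt1|].
  by move/long_relword_reduced => /(_ u_gt1)/reduce_id ->.
case: u => [|a [|//]] _; first by [].
by rewrite reduce_seq1 rep_letter_nf.
Qed.

Lemma relword_rigid u : relword u -> rigid u.
Proof.
move=> ru x w y w' def_u _ /rep_eq_or_relword[-> // | [rw _]] _.
by apply: relword_factor rw; rewrite -def_u.
Qed.

Lemma rigid_factor x u y : rigid (x ++ u ++ y) -> rigid u.
Proof.
move=> rig x' w y' w' def_u red_w' rep_w neq_w.
have [] := rig (x ++ x') w (y' ++ y) w' _ red_w' rep_w neq_w.
  by rewrite def_u -!catA.
by case: x {rig} => //=; case: x' {def_u} => // _; case: y'.
Qed.

Lemma rigid_rep u v : rep u = rep v -> rigid u -> rigid v.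
Proof. by case/rep_eq_or_relword=> [-> //|[_ /relword_rigid]]. Qed.

Lemma rigid_short u : size u <= 1 -> rigid u.
Proof.
move=> u_le1 x w y w' def_u _ rep_w neq_w.
have : 0 < size w.
  rewrite lt0n size_eq0; apply/eqP=> w0; case: neq_w; rewrite w0 in rep_w *.
  by rewrite (rep_eq_nil (esym rep_w)).
case: w {rep_w neq_w} def_u => // a w def_u _; move: u_le1.
rewrite def_u !size_cat addnS ltnS leqn0 !addn_eq0 !size_eq0.
by case/and3P=> /eqP -> _ /eqP ->.
Qed.

Lemma rep_reduce_step l r x y :
  relword l -> relword r -> rep l = rep r -> rigid (reduce (x ++ l ++ y)) ->
  rep (reduce (x ++ l ++ y)) = rep (reduce (x ++ r ++ y)).
Proof.
move=> rl rr rep_lr; rewrite !reduce_cat => rig.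
have rep_red : rep (reduce l) = rep (reduce r) by rewrite !rep_reduce_relword.
have [-> //|/eqP neq_lr] := eqVneq (reduce l) (reduce r).
by have [-> ->] := rig _ _ _ _ erefl (reduce_reduced r) rep_red neq_lr; rewrite !cats0.
Qed.

Lemma cong_rigid u v : cong u v -> rigid (reduce u) -> rep (reduce u) = rep (reduce v).
Proof.
move=> uv rig_u.
suff : rigid (reduce u) \/ rigid (reduce v) -> rep (reduce u) = rep (reduce v).
  by apply; left.
elim: uv {rig_u} => [l r x y lrP | // | w w' _ IH | w1 w2 w3 _ IH12 _ IH23].
- have [rl rr] := rel_relword lrP; have rep_lr := rel_rep lrP.
  by case; [|move=> rig; apply/esym; move: rig]; apply: rep_reduce_step.
- by move=> rig; apply/esym/IH; case: rig; [right | left].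
case=> [rig1|rig3].
  have rep12 := IH12 (or_introl rig1); rewrite rep12.
  by apply: IH23; left; apply: rigid_rep rep12 rig1.
have rep23 := IH23 (or_intror rig3); rewrite -rep23.
by apply: IH12; right; apply: rigid_rep (esym rep23) rig3.
Qed.

Lemma reduced_cong_rigid u v :
  reduced u -> reduced v -> rigid u -> cong u v -> rep u = rep v.
Proof.
move=> /reduce_id red_u /reduce_id red_v rig_u /cong_rigid.
by rewrite red_u red_v; apply.
Qed.

Lemma cong_nil u : cong u [::] -> u = [::].
Proof.
move/cong_sym/cong_rigid => /(_ (@rigid_short [::] isT)).
by move/esym/rep_eq_nil; apply: reduce_eq_nil.
Qed.

Lemma cong_irreducible a u :
  irreducible a -> reduced u -> cong [:: a] u -> u = [:: a].
Proof.
move=> irr_a red_u /reduced_cong_rigid cong_au; apply: rep_irreducible => //.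
apply/esym/cong_au => //; first by rewrite /reduced /= irr_a.
exact: rigid_short.
Qed.

End InfixCode.

(** * Isomorphisms *)

Record inverse_homs (P Q : pres) (F : word P -> word Q) (G : word Q -> word P) :
    Prop := {
  hom_cong : forall u v, cong u v -> cong (F u) (F v);
  hom_cat : forall u v, cong (F (u ++ v)) (F u ++ F v);
  hom_nil : cong (F [::]) [::];
  inv_cong : forall u v, cong u v -> cong (G u) (G v);
  homK : forall u, cong (G (F u)) u;
  invK : forall w, cong (F (G w)) w
}.

Lemma inverse_homs_sym (P Q : pres) (F : word P -> word Q) (G : word Q -> word P) :
  inverse_homs F G -> inverse_homs G F.
Proof.
move=> [Fcong Fcat F0 Gcong FK GK]; split=> // [u v|].
  apply: cong_trans (FK _); apply: Gcong; apply: cong_trans (cong_sym (Fcat _ _)).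
  by apply: cong_cat; apply/cong_sym/GK.
by apply: (cong_trans (Gcong _ _ (cong_sym F0))); apply: FK.
Qed.

Definition retracted_hom (P Q : pres) (f : 'I_(alpha P) -> word Q)
    (g : 'I_(alpha Q) -> word P) : Prop :=
  (forall l r, (l, r) \in rels P -> rep (free_hom f l) = rep (free_hom f r)) /\
  (forall a, rep (free_hom g (f a)) = rep [:: a]).

Section RetractedHom.

Variables (P Q : pres) (f : 'I_(alpha P) -> word Q) (g : 'I_(alpha Q) -> word P).
Hypothesis fg : retracted_hom f g.
Implicit Types u v : word P.

Lemma retracted_hom_cong u v : cong u v -> cong (free_hom f u) (free_hom f v).
Proof.
have [f_rel _] := fg.
elim=> [l r x y /f_rel/rep_cong lr | w | w w' _ | w1 w2 w3 _ + _].
- by rewrite !free_hom_cat; apply: cong_context.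
- exact: cong_refl.
- exact: cong_sym.
exact: cong_trans.
Qed.

Lemma retracted_homK u : cong (free_hom g (free_hom f u)) u.
Proof.
have [_ fK] := fg; rewrite free_hom_comp -[u in cong _ u]flatten_seq1.
by apply: cong_free_hom => a; apply: rep_cong.
Qed.

End RetractedHom.

Lemma retracted_hom_iso (P Q : pres) (f : 'I_(alpha P) -> word Q)
    (g : 'I_(alpha Q) -> word P) :
  retracted_hom f g -> retracted_hom g f -> presented_iso P Q.
Proof.
move=> fg gf; exists (free_hom f), (free_hom g).
split; first exact: retracted_hom_cong fg.
split; first by move=> u v; rewrite free_hom_cat; apply: cong_refl.
split; first exact: cong_refl.
split; first exact: retracted_hom_cong gf.
by split; apply: retracted_homK.
Qed.

Definition letter_image (P Q : pres) (F : word P -> word Q) (a : 'I_(alpha P)) :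
  word Q := reduce (F [:: a]).

Definition reduced_hom (P Q : pres) (F : word P -> word Q) : word P -> word Q :=
  free_hom (letter_image F).

Definition gen_image (P Q : pres) (F : word P -> word Q) (a : 'I_(alpha P)) :
  word Q := reduced_hom F (letter_nf a).

Lemma reduced_hom_cat (P Q : pres) (F : word P -> word Q) u v :
  reduced_hom F (u ++ v) = reduced_hom F u ++ reduced_hom F v.
Proof. exact: free_hom_cat. Qed.

Lemma free_hom_gen_image (P Q : pres) (F : word P -> word Q) u :
  free_hom (gen_image F) u = reduced_hom F (reduce u).
Proof. by rewrite /reduced_hom /reduce free_hom_comp. Qed.

Section ReducedHom.

Variables (P Q : pres) (F : word P -> word Q) (G : word Q -> word P).
Hypotheses (P_code : infix_code P) (Q_code : infix_code Q).
Hypothesis FG : inverse_homs F G.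
Implicit Types (a : 'I_(alpha P)) (u v : word P).

Lemma cong_reduced_hom u : cong (F u) (reduced_hom F u).
Proof.
elim: u => [|a u IHu]; first exact: hom_nil FG.
apply: cong_trans (hom_cat FG [:: a] u) (cong_cat _ IHu).
exact/cong_sym/reduce_cong.
Qed.

Lemma reduced_hom_cong u v : cong u v -> cong (reduced_hom F u) (reduced_hom F v).
Proof.
move=> uv; apply: cong_trans (cong_sym (cong_reduced_hom u)) _.
exact: cong_trans (hom_cong FG uv) (cong_reduced_hom v).
Qed.

Lemma letter_image_neq0 a : letter_image F a <> [::].
Proof.
move/reduce_eq_nil => /(_ Q_code) Fa0.
suff /(cong_nil P_code) : cong [:: a] [::] by [].
apply: cong_trans (cong_sym (homK FG _)) _; rewrite Fa0.
exact: hom_nil (inverse_homs_sym FG).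
Qed.

Lemma reduced_hom_reduced u : reduced (reduced_hom F u).
Proof.
by elim: u => // a u IHu; rewrite [reduced_hom F _]/= reduced_cat reduce_reduced.
Qed.

End ReducedHom.

Section ReducedHomK.

Variables (P Q : pres) (F : word P -> word Q) (G : word Q -> word P).
Hypotheses (P_code : infix_code P) (Q_code : infix_code Q).
Hypothesis FG : inverse_homs F G.
Implicit Types (a : 'I_(alpha P)) (u v : word P).

Let GF : inverse_homs G F := inverse_homs_sym FG.

Lemma reduced_homK u : reduced u -> reduced_hom G (reduced_hom F u) = u.
Proof.
elim: u => // a u IHu /andP[irr_a /IHu GFu].
rewrite -cat1s [reduced_hom F _]reduced_hom_cat reduced_hom_cat GFu; congr (_ ++ _).
apply: cong_irreducible => //; first exact: reduced_hom_reduced.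
apply: cong_trans (cong_reduced_hom GF _).
apply: cong_trans (cong_sym (homK FG _)) _; apply: (inv_cong FG).
exact: cong_reduced_hom FG _.
Qed.

Lemma size_reduced_hom u : reduced u -> size (reduced_hom F u) = size u.
Proof.
move=> red_u; apply/eqP; rewrite eqn_leq.
rewrite -[X in _ <= size X]reduced_homK // !size_free_hom_ge //.
  exact: letter_image_neq0 FG.
exact: letter_image_neq0 GF.
Qed.

End ReducedHomK.

Section GenImage.

Variables (P Q : pres) (F : word P -> word Q) (G : word Q -> word P).
Hypotheses (P_code : infix_code P) (Q_code : infix_code Q).
Hypothesis FG : inverse_homs F G.
Implicit Types (a : 'I_(alpha P)) (u v : word P).

Let GF : inverse_homs G F := inverse_homs_sym FG.

Lemma reduced_hom_rigid u : reduced u -> rigid u -> rigid (reduced_hom F u).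
Proof.
move=> red_u rig_u x w y w' im_u red_w' rep_w neq_w.
have : reduced (reduced_hom F u) by apply: reduced_hom_reduced.
rewrite im_u !reduced_cat => /and3P[red_x red_w red_y].
have GK := reduced_homK Q_code GF.
have def_u : u = reduced_hom G x ++ reduced_hom G w ++ reduced_hom G y.
  by rewrite -!reduced_hom_cat -im_u (reduced_homK P_code FG).
have rep_Gw : rep (reduced_hom G w) = rep (reduced_hom G w').
  apply: reduced_cong_rigid => //; try exact: reduced_hom_reduced.
    by apply: (@rigid_factor _ (reduced_hom G x) _ (reduced_hom G y)); rewrite -def_u.
  exact/(reduced_hom_cong GF)/rep_cong.
have neq_Gw : reduced_hom G w <> reduced_hom G w'.
  by move=> eq_Gw; case: neq_w; rewrite -(GK w red_w) eq_Gw GK.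
have [Gx0 Gy0] := rig_u _ _ _ _ def_u (reduced_hom_reduced G P_code w') rep_Gw neq_Gw.
by rewrite -(GK x red_x) -(GK y red_y) Gx0 Gy0.
Qed.

Lemma rep_reduced_hom u v :
  reduced u -> reduced v -> rep u = rep v ->
  rep (reduced_hom F u) = rep (reduced_hom F v).
Proof.
move=> red_u red_v rep_uv; have [-> //|[ru _]] := rep_eq_or_relword rep_uv.
apply: reduced_cong_rigid; rewrite ?reduced_hom_reduced //.
  exact: reduced_hom_rigid (relword_rigid P_code ru).
exact/(reduced_hom_cong FG)/rep_cong.
Qed.

Lemma gen_image_retracted_hom : retracted_hom (gen_image F) (gen_image G).
Proof.
split=> [l r lrP|a]; rewrite !free_hom_gen_image.
  have [rl rr] := rel_relword lrP.
  apply: rep_reduced_hom; rewrite ?reduce_reduced ?rep_reduce_relword //.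
  exact: rel_rep.
rewrite /gen_image reduce_id ?reduced_hom_reduced //.
by rewrite (reduced_homK P_code FG) ?letter_nf_reduced ?rep_letter_nf.
Qed.

Lemma size_gen_image a : size (gen_image F a) = size (letter_nf a).
Proof. exact: (size_reduced_hom P_code Q_code FG (letter_nf_reduced P_code a)). Qed.

End GenImage.

(** * Correctness of the decision procedure *)

Definition pres_to_data (P : pres) : pres_data :=
  (alpha P, [seq (map val lr.1, map val lr.2) | lr <- rels P]).

Definition represents (P Q : pres) (fl : seq (seq nat))
    (f : 'I_(alpha P) -> word Q) : Prop :=
  forall a : 'I_(alpha P), nth [::] fl a = map val (f a).

Section Data.

Variables P Q : pres.
Implicit Types (fl : seq (seq nat)) (f : 'I_(alpha P) -> word Q) (u v : word P).

Lemma eq_class_rep_data u v :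
  (class_rep (pres_to_data P).2 (map val u) ==
   class_rep (pres_to_data P).2 (map val v)) = (rep u == rep v).
Proof.
by rewrite !(class_rep_map _ _ (inj_map val_inj)) (inj_eq (inj_map val_inj)).
Qed.

Lemma free_hom_represents fl f u :
  represents fl f -> free_hom (nth [::] fl) (map val u) = map val (free_hom f u).
Proof.
move=> fl_f; rewrite /free_hom map_flatten -!map_comp.
by congr flatten; apply: eq_map => a; apply: fl_f.
Qed.

Lemma size_letter_nf_le (a : 'I_(alpha P)) :
  size (letter_nf a) <= length_bound (pres_to_data P).
Proof.
have [-> //|[[l [r [lrP nf_a]]] _]] := rep_eq_or_relword (rep_letter_nf a).
apply: leqW; have /splitPr[s1 s2] : (map val l, map val r) \in (pres_to_data P).2.
  by apply/mapP; exists (l, r).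
rewrite map_cat flatten_cat /= !size_cat !size_map.
apply: leq_trans (leq_addl _ _); apply: leq_trans (leq_addr _ _).
by case: nf_a => ->; [apply: leq_addr | apply: leq_addl].
Qed.

Lemma candidate_represents fl :
  fl \in candidates (pres_to_data P) (pres_to_data Q) ->
  represents fl (fun a : 'I_(alpha P) => pmap insub (nth [::] fl a) : word Q).
Proof.
rewrite mem_seqs_upto => /andP[_ /allP fl_words] a /=.
rewrite (pmap_filter (insubK _)); apply/esym/all_filterP.
have [ltafl|lefla] := ltnP a (size fl); last by rewrite nth_default.
have := fl_words _ (mem_nth [::] ltafl); rewrite inE mem_seqs_upto => /andP[_].
by apply: sub_all => k; rewrite /= mem_iota isSome_insub.
Qed.

Lemma bounded_hom_candidate f :
  (forall a, size (f a) <= length_bound (pres_to_data P)) ->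
  exists2 fl, fl \in candidates (pres_to_data P) (pres_to_data Q) & represents fl f.
Proof.
move=> f_size; exists [seq map val (f a) | a <- enum 'I_(alpha P)]; last first.
  by move=> a; rewrite (nth_map a) ?nth_ord_enum // size_enum_ord.
rewrite mem_seqs_upto size_map size_enum_ord leqnn andTb.
apply/allP=> _ /mapP[a _ ->]; rewrite inE mem_seqs_upto size_map f_size /=.
by apply/allP=> _ /mapP[b _ ->]; rewrite inE mem_iota /=.
Qed.

End Data.

Lemma check_retracted_homP (P Q : pres) fl gl (f : 'I_(alpha P) -> word Q)
    (g : 'I_(alpha Q) -> word P) :
  represents fl f -> represents gl g ->
  reflect (retracted_hom f g)
    (check_retracted_hom (pres_to_data P) (pres_to_data Q) fl gl).
Proof.
move=> fl_f gl_g; rewrite /check_retracted_hom /= -val_enum_ord !all_map.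
pose rel_ok (lr : word P * word P) := rep (free_hom f lr.1) == rep (free_hom f lr.2).
pose letter_ok a := rep (free_hom g (f a)) == rep [:: a].
rewrite (@eq_all _ _ rel_ok) => [|lr]; last first.
  by rewrite /= !(free_hom_represents _ fl_f) eq_class_rep_data.
rewrite (@eq_all _ _ letter_ok) => [|a]; last first.
  by rewrite /= fl_f (free_hom_represents _ gl_g) /letter_ok -eq_class_rep_data.
apply: (iffP andP) => [[/allP f_rel /allP fK]|[f_rel fK]]; split.
- by move=> l r /f_rel/eqP.
- by move=> a; apply/eqP/fK; rewrite -enumT mem_enum.
- by apply/allP=> -[l r] /f_rel/eqP.
by apply/allP=> a _; apply/eqP.
Qed.

Lemma decide_isoP (P Q : pres) : infix_code P -> infix_code Q ->
  reflect (presented_iso P Q) (decide_iso (pres_to_data P) (pres_to_data Q)).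
Proof.
move=> P_code Q_code; apply: (iffP hasP).
  move=> [fl /candidate_represents fl_f /hasP[gl /candidate_represents gl_g]].
  case/andP=> /(check_retracted_homP fl_f gl_g) fg /(check_retracted_homP gl_g fl_f).
  exact: retracted_hom_iso.
move=> [F [G [Fcong [Fcat [F0 [Gcong [FK GK]]]]]]].
have FG : inverse_homs F G by split.
have GF := inverse_homs_sym FG.
have [a|fl fl_cand fl_f] := @bounded_hom_candidate P Q (gen_image F).
  by rewrite (size_gen_image P_code Q_code FG) size_letter_nf_le.
have [a|gl gl_cand gl_g] := @bounded_hom_candidate Q P (gen_image G).
  by rewrite (size_gen_image Q_code P_code GF) size_letter_nf_le.
exists fl => //; apply/hasP; exists gl => //; apply/andP; split.
  by apply/(check_retracted_homP fl_f gl_g); apply: gen_image_retracted_hom FG.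
by apply/(check_retracted_homP gl_g fl_f); apply: gen_image_retracted_hom GF.
Qed.

Theorem theorem2 :
  exists c : code,
    forall P Q : pres, Csc 2 P -> Csc 2 Q ->
      (presented_iso P Q -> eval c [:: encode P; encode Q] 1) /\
      (~ presented_iso P Q -> eval c [:: encode P; encode Q] 0).
Proof.
have [c ev_c] := computable_decide_iso.
exists (CComp c [:: code_pair]) => P Q /Csc2_infix_code P_code /Csc2_infix_code Q_code.
have ev_pair := eval_pair (pres_to_data P) (pres_to_data Q).
have := eval_comp1 ev_pair (ev_c (_, _)); rewrite pickle_bool /=.
by case: (decide_isoP P_code Q_code) => iso ev.
Qed.
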